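(* Fix $\alpha>0$ and, for each $n$, let $N=\lfloor e^{\alpha n}\rfloor$. There exists (for each $n$) a symmetric isotropic probability measure $\nu_n$ on $\mathbb{R}^n$ with $\operatorname{supp}\nu_n=\mathbb{R}^n$, which is not log-concave, such that for independent $X_1,\ldots,X_N$ with law $\nu_n$ and $P_N=\operatorname{conv}\{X_1,\ldots,X_N\}$ one has $$\mathbb{E}\, f_{n-1}(P_N)=(1+o(1))\,2^n\qquad(n\to\infty).$$ In particular, $\mathbb{E}\, f_{n-1}(P_N)=e^{O(n)}$, and for every fixed $C>0$, $\mathbb{E}\, f_{n-1}(P_N)\big/\bigl(n^{n/2}e^{-Cn}\bigr)\to 0$ as $n\to\infty$.
   Context: Symmetric means invariant under $x\mapsto -x$. Isotropic means having barycenter $0$ and identity covariance matrix. For a polytope $P$ in $\mathbb{R}^n$, $f_{n-1}(P)$ denotes its number of facets, i.e. of $(n-1)$-dimensional faces. *)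

(* Defs.v *)
From HB Require Import structures.
From mathcomp Require Export all_boot all_order all_algebra finmap.
From mathcomp Require Export all_classical all_reals all_analysis.
Export Order.TTheory GRing.Theory Num.Theory.
Export numFieldNormedType.Exports.

Set Implicit Arguments.
Unset Strict Implicit.
Unset Printing Implicit Defensive.

Local Open Scope classical_set_scope.
Local Open Scope ring_scope.

Definition borel_rV (R : realType) (n : nat) :=
  g_sigma_algebraType (@open 'rV[R]_n).

Section measures.
Variables (R : realType) (n : nat).
Implicit Type nu : probability (borel_rV R n) R.

Definition coord (i : 'I_n) (x : borel_rV R n) : R :=
  (x : 'rV[R]_n) ord0 i.

Definition symmetric_measure nu : Prop :=
  forall A : set (borel_rV R n), measurable A ->
    nu [set x : 'rV[R]_n | A (- x)] = nu A.

(* Square-integrability makes the expectations and covariances below finite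
   and meaningful. *)
Definition isotropic nu : Prop :=
  [/\ forall i, nu.-integrable setT (fun x => (coord i x ^+ 2)%:E),
      forall i, ('E_nu[coord i] = 0)%E &
      forall i j, covariance nu (coord i) (coord j) = ((i == j)%:R)%:E].

Definition measure_support nu : set 'rV[R]_n :=
  [set x | forall U : set 'rV[R]_n, open U -> U x -> (0 < nu U)%E].

(* Log-concavity of measures in the sense of Borell; compactness
   makes the Minkowski combination on the right measurable. For t in ]0, 1[ the
   inequality is trivial when A or B is empty, as 0 `^ t = 0. *)
Definition log_concave_measure nu : Prop :=
  forall (A B : set 'rV[R]_n) (t : R), compact A -> compact B -> 0 < t < 1 ->
    (nu A `^ t * nu B `^ (1 - t) <=
     nu [set (t *: a + (1 - t) *: b)%R | a in A & b in B])%E.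

End measures.

Section independence.
Context {d d' : measure_display} {T : measurableType d}
  {T' : measurableType d'} {R : realType} {P : probability T R}.

Definition mutually_independent (I : finType) (X : I -> {RV P >-> T'}) : Prop :=
  forall (J : {set I}) (A : I -> set T'), (forall i, measurable (A i)) ->
    P (\bigcap_(i in [set` J]) X i @^-1` A i) =
    (\prod_(i in J) P (X i @^-1` A i))%E.

Definition iid_sample (nu : probability T' R) (I : finType)
    (X : I -> {RV P >-> T'}) : Prop :=
  mutually_independent X /\
  forall i (A : set T'), measurable A -> distribution P (X i) A = nu A.

End independence.

Section polytopes.
Variables (R : realType) (n : nat).
Implicit Types F P : set 'rV[R]_n.

Definition conv_hull (I : finType) (x : I -> 'rV[R]_n) : set 'rV[R]_n :=
  [set y | exists w : I -> R, [/\ forall i, 0 <= w i, \sum_i w i = 1 &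
     y = \sum_i w i *: x i]].

(* x0 + V is the affine hull of F. *)
Definition has_affine_dim F (k : nat) : Prop :=
  exists (x0 : 'rV[R]_n) (V : {vspace 'rV[R]_n}),
    [/\ F x0, forall x, F x -> x - x0 \in V,
        forall W : {vspace 'rV[R]_n},
          (forall x, F x -> x - x0 \in W) -> (V <= W)%VS &
        \dim V = k].

(* The nonempty faces of a polytope P; l = 0 gives P itself. *)
Definition is_face P F : Prop :=
  exists l : {scalar 'rV[R]_n},
    F = [set x | P x /\ forall y, P y -> l y <= l x].

Definition faces P (k : nat) : set (set 'rV[R]_n) :=
  [set F | is_face P F /\ has_affine_dim F k].

Definition nb_faces (k : nat) P : nat := #|` fset_set (faces P k)|%fset.

(* fset_set sends infinite sets to fset0; nb_faces is used on polytopes only. *)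
Lemma finite_faces (I : finType) (x : I -> 'rV[R]_n) (k : nat) :
  finite_set (faces (conv_hull x) k).
Proof.
pose g (J : {set I}) : set 'rV[R]_n :=
  [set y | exists w : I -> R, [/\ forall i, 0 <= w i, \sum_i w i = 1,
     y = \sum_i w i *: x i & forall i, i \notin J -> w i = 0]].
apply: (@sub_finite_set _ _ (range g)); last exact: finite_image (@finite_finset _ _).
move=> F [[l FE] _].
pose J : {set I} := finset (fun i => `[< F (x i) >]).
have JE i : (i \in J) = `[< F (x i) >] by rewrite finset.in_set.
exists J => //; apply/seteqP; split => y /=.
  move=> [w [w0 w1 yE wJ]]; rewrite FE; split; first by exists w.
  move=> z Pz; rewrite yE linear_sum /= -[l z]mul1r -w1 mulr_suml.
  apply: ler_sum => i _; rewrite linearZ /=.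
  have [iJ|/wJ ->] := boolP (i \in J); last by rewrite !mul0r.
  apply: ler_wpM2l => //.
  have : F (x i) by apply/asboolP; rewrite -JE.
  by rewrite FE => -[_ xmax]; exact: xmax.
move=> Fy; move: (Fy); rewrite {1}FE /= => -[[w [w0 w1 yE]] ymax].
exists w; split=> // i iJ; apply/eqP/contraT => wi.
have xP j : conv_hull x (x j).
  exists (fun k => (k == j)%:R); split=> [k'||].
  - by rewrite ler0n.
  - by rewrite (bigD1 j) //= eqxx big1 ?addr0// => m /negPf ->.
  - by rewrite (bigD1 j) //= eqxx scale1r big1 ?addr0// => m /negPf ->;
      rewrite scale0r.
have lxi : l (x i) < l y.
  rewrite lt_neqAle ymax ?andbT; last exact: xP.
  apply: contra iJ => /eqP lE; rewrite JE FE; apply/asboolP.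
  by split=> [|z Pz]; [exact: xP | rewrite lE; exact: ymax].
suff : l y < l y by rewrite ltxx.
rewrite {1}yE linear_sum /= -[ltRHS]mul1r -w1 mulr_suml.
rewrite (bigD1 i) //= [ltRHS](bigD1 i) //=.
apply: ltr_leD; first by rewrite linearZ /= ltr_pM2l // lt_neqAle eq_sym wi w0.
by apply: ler_sum => j _; rewrite linearZ /= ler_wpM2l // ymax.
Qed.

End polytopes.

Definition sample_size (R : realType) (alpha : R) (n : nat) : nat :=
  Num.truncn (expR (alpha * n%:R)).

(* Main.v *)
(* nu_n puts almost all its mass, uniformly, on the vertices a_i e_i and -a_i e_i
   of a cross-polytope, and a tiny mass (of order 2^-N) on a dense countable
   set, which yields full support. Averaging over the sign changes of the
   coordinates makes the covariance diagonal, and the a_i normalize it. With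
   N exponential in n, a coupon-collector bound shows that with overwhelming
   probability the sample is exactly the vertex set of the cross-polytope, whose
   hull has 2^n facets. The exceptional events are controlled by crude facet
   counts: a face is determined by the generators it contains, so there are at
   most 4^n facets when all points are among the 2n vertices, and 2^N always.
   A convex combination of two opposite atoms of mass about 1/(2n) is the
   origin, of tiny mass, which contradicts log-concavity. *)
From HB Require Import structures.
Require Import Defs.
From mathcomp Require Import measurable_realfun ring lra.

Set Implicit Arguments.
Unset Strict Implicit.
Unset Printing Implicit Defensive.

Local Open Scope classical_set_scope.
Local Open Scope ring_scope.

(** * Faces of the convex hull of a finite family *)

Section faces_of_convex_hulls.
Variables (R : realType) (n : nat) (I : finType) (x : I -> 'rV[R]_n).

Lemma conv_hull_gen i : conv_hull x (x i).
Proof.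
exists (fun j => (j == i)%:R); split => [j||].
- by rewrite ler0n.
- by rewrite (bigD1 i) //= eqxx big1 ?addr0// => j /negPf ->.
- rewrite (bigD1 i) //= eqxx scale1r big1 ?addr0// => j /negPf ->.
  by rewrite scale0r.
Qed.

Lemma face_sub (F : set 'rV[R]_n) : is_face (conv_hull x) F ->
  F `<=` conv_hull x.
Proof. by move=> [l ->] y []. Qed.

(** A linear form takes at a convex combination the weighted mean of its values at the generators,
    so it is maximal there exactly when it is maximal at every generator of nonzero weight. *)
Lemma face_convex_combination (F : set 'rV[R]_n) (w : I -> R) :
  is_face (conv_hull x) F -> (forall i, 0 <= w i) -> \sum_i w i = 1 ->
  F (\sum_i w i *: x i) <-> (forall i, w i != 0 -> F (x i)).
Proof.
move=> [l ->] w0 w1; set y := \sum_i _.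
have Py : conv_hull x y by exists w.
have ly : l y = \sum_i w i * l (x i).
  by rewrite linear_sum; apply: eq_bigr => i _; rewrite linearZ.
split=> [[_ ymax] i wi|Fw].
  split=> [|z Pz]; first exact: conv_hull_gen.
  apply: (le_trans (ymax _ Pz)); rewrite leNgt; apply/negP => xy.
  suff : l y < l y by rewrite ltxx.
  rewrite {1}ly -[ltRHS]mul1r -w1 mulr_suml (bigD1 i) //= [ltRHS](bigD1 i) //=.
  apply: ltr_leD; first by rewrite ltr_pM2l // lt_neqAle eq_sym wi w0.
  by apply: ler_sum => j _; rewrite ler_wpM2l // ymax //; exact: conv_hull_gen.
split=> // z Pz; rewrite ly -[leLHS]mul1r -w1 mulr_suml.
apply: ler_sum => i _; have [->|wi] := eqVneq (w i) 0; first by rewrite !mul0r.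
by rewrite ler_wpM2l //; apply: (Fw i wi).2.
Qed.

Lemma face_nonempty_gen (F : set 'rV[R]_n) y : is_face (conv_hull x) F ->
  F y -> exists i, F (x i).
Proof.
move=> fF Fy; have [w [w0 w1 yE]] := face_sub fF Fy.
have [i wi] : exists i, w i != 0.
  apply: contrapT => /forallNP w_eq0.
  move: w1; rewrite big1 => [/esym/eqP|i _]; first by rewrite oner_eq0.
  by apply/eqP/negPn/negP/w_eq0.
exists i; move: Fy; rewrite yE => /(face_convex_combination fF w0 w1).
exact.
Qed.

Lemma face_le (F G : set 'rV[R]_n) : is_face (conv_hull x) F ->
  is_face (conv_hull x) G -> (forall i, F (x i) -> G (x i)) -> F `<=` G.
Proof.
move=> fF fG FG y Fy; have [w [w0 w1 yE]] := face_sub fF Fy.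
move: Fy; rewrite yE => /(face_convex_combination fF w0 w1) wF.
by apply/(face_convex_combination fG w0 w1) => i wi; apply/FG/wF.
Qed.

Lemma face_eq (F G : set 'rV[R]_n) : is_face (conv_hull x) F ->
  is_face (conv_hull x) G -> (forall i, F (x i) <-> G (x i)) -> F = G.
Proof.
by move=> fF fG FG; apply/seteqP; split; apply: face_le => // i /FG.
Qed.

(** A face is encoded by the set of [v j] that it contains, which is injective by [face_eq]. The
    family [v] is separate from [x] so that a long sample with many repetitions is counted by its
    possible values. *)
Lemma nb_faces_le (J : finType) (v : J -> 'rV[R]_n) (k : nat) :
  (forall i, exists j, x i = v j) ->
  (nb_faces k (conv_hull x) <= 2 ^ #|J|)%N.
Proof.
move=> xv; rewrite /nb_faces.
pose h (F : set 'rV[R]_n) : {set J} := finset (fun j => `[< F (v j) >]).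
have fin := finite_faces x k.
have hinj : {in fset_set (faces (conv_hull x) k) &, injective h}.
  move=> F G; rewrite !in_fset_set// !inE => -[fF _] [fG _] /setP hFG.
  apply: face_eq => // i; have [j ->] := xv i.
  by have := hFG j; rewrite !finset.in_set => e; split=> /asboolP;
    [rewrite e|rewrite -e] => /asboolP.
have -> : (2 ^ #|J| = #|{set J}|)%N.
  by rewrite -(cardsT J) -card_powerset powersetT cardsT.
have -> : #|` fset_set (faces (conv_hull x) k)|%fset =
    size (map h (fset_set (faces (conv_hull x) k))) by rewrite size_map.
rewrite cardT; apply: uniq_leq_size => [|S _]; last by rewrite mem_enum.
by rewrite map_inj_in_uniq ?fset_uniq.
Qed.

End faces_of_convex_hulls.

(** Rank-nullity for [l] seen as a map into 1 by 1 matrices; a vector with [l y != 0] makes the rank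
    equal to 1. *)
Lemma scalar_kernel (R : realType) (n : nat) (l : {scalar 'rV[R]_n}) :
  exists2 K : {vspace 'rV[R]_n}, forall y, (y \in K) = (l y == 0) &
    forall y, l y != 0 -> \dim K = n.-1.
Proof.
pose f : 'Hom('rV[R]_n, 'rV[R]_1) :=
  linfun (mulmxr (\col_i l (delta_mx ord0 i))).
have fE y : f y = const_mx (l y).
  rewrite lfunE /=; apply/rowP => j; rewrite !mxE {2}(row_sum_delta y).
  by rewrite linear_sum; apply: eq_bigr => i _; rewrite linearZ mxE.
exists (lker f) => [y|y ly].
  rewrite memv_ker fE; apply/eqP/eqP => [/rowP/(_ ord0)|->].
    by rewrite !mxE.
  by apply/rowP => j; rewrite !mxE.
have := limg_ker_dim f fullv; rewrite capfv dimvf /dim /= mul1n.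
suff -> : \dim (limg f) = 1%N by rewrite addn1 => /(congr1 predn).
apply/eqP; rewrite eqn_leq; apply/andP; split.
  by apply: leq_trans (dimvS (subvf _)) _; rewrite dimvf /dim.
rewrite lt0n dimv_eq0; apply: contraNneq ly => f0.
have : f y \in limg f by apply: memv_img; exact: memvf.
by rewrite f0 memv0 fE => /eqP/rowP/(_ ord0); rewrite !mxE => ->.
Qed.

(** * The cross-polytope and its facets *)

Definition cross_vertex (R : realType) (n : nat) (a : 'I_n -> R)
    (k : 'I_n * bool) : 'rV[R]_n :=
  ((-1) ^+ k.2 * a k.1) *: delta_mx ord0 k.1.

(** The inequalities [sign_form a s y <= 1], one for each sign vector [s], cut out the
    cross-polytope when all [a i] are positive. *)
Definition sign_form (R : realType) (n : nat) (a : 'I_n -> R)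
    (s : {ffun 'I_n -> bool}) (y : 'rV[R]_n) : R :=
  \sum_i (-1) ^+ s i * (a i)^-1 * y ord0 i.

Fact sign_form_is_linear R n a s : scalar (@sign_form R n a s).
Proof.
move=> c y z; rewrite /sign_form mulr_sumr -big_split; apply: eq_bigr => i _ /=.
by rewrite !mxE mulrDr mulrCA.
Qed.

HB.instance Definition _ (R : realType) n (a : 'I_n -> R) s :=
  GRing.isLinear.Build R 'rV[R]_n R *%R (@sign_form R n a s)
    (sign_form_is_linear a s).

Section cross_polytope.
Variables (R : realType) (n : nat) (a : 'I_n -> R) (a_gt0 : forall i, 0 < a i).
Implicit Type s : {ffun 'I_n -> bool}.

Lemma cross_vertexN i b :
  cross_vertex a (i, ~~ b) = - cross_vertex a (i, b).
Proof. by rewrite /cross_vertex /= signrN mulNr scaleNr. Qed.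

Lemma sign_form_vertex s i b :
  sign_form a s (cross_vertex a (i, b)) = (-1) ^+ (s i (+) b).
Proof.
rewrite /sign_form (bigD1 i) //= big1 ?addr0 => [|j /negPf ji].
  rewrite !mxE !eqxx mulr1 mulrACA -signr_addb mulVf ?mulr1//.
  by rewrite gt_eqF.
by rewrite !mxE ji andbF mulr0n !mulr0.
Qed.

Variables (I : finType) (x : I -> 'rV[R]_n).
Hypothesis xE : forall i, exists k, x i = cross_vertex a k.
Hypothesis Ex : forall k, exists i, x i = cross_vertex a k.
Let P := conv_hull x.

Let P_vertex k : P (cross_vertex a k).
Proof. by have [i <-] := Ex k; exact: conv_hull_gen. Qed.

Definition sign_facet s : set 'rV[R]_n :=
  [set y | P y /\ forall z, P z -> sign_form a s z <= sign_form a s y].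

Let sign_facet_face s : is_face P (sign_facet s).
Proof. by exists (sign_form a s). Qed.

Let sign_form_le s y : P y -> sign_form a s y <= 1.
Proof.
move=> [w [w0 w1 ->]]; rewrite linear_sum -w1; apply: ler_sum => i _.
rewrite linearZ /= -[leRHS]mulr1; apply: ler_wpM2l => //.
by have [[j b] ->] := xE i; rewrite sign_form_vertex; case: (_ (+) _); lra.
Qed.

(** The index [i] supplies a vertex, [(i, s i)], at which the upper bound 1 is attained. *)
Let sign_facetP s (i : 'I_n) y : sign_facet s y <-> P y /\ sign_form a s y = 1.
Proof.
split=> -[Py]; last by move=> y1; split=> // z /(sign_form_le s); rewrite y1.
move=> /(_ _ (P_vertex (i, s i))); rewrite sign_form_vertex addbb expr0 => y1.
by split=> //; apply/eqP; rewrite eq_le y1 sign_form_le.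
Qed.

Let sign_facet_vertex s (i j : 'I_n) b :
  sign_facet s (cross_vertex a (i, b)) <-> b = s i.
Proof.
rewrite (sign_facetP _ j) sign_form_vertex; split=> [[_]|->].
  by case: (s i) b => -[] //= /eqP; rewrite lt_eqF //; lra.
by rewrite addbb.
Qed.

(** The direction space of the facet is the kernel of its form: edge vectors from one vertex of the
    facet span that kernel. *)
Let sign_facet_dim s (i0 : 'I_n) : has_affine_dim (sign_facet s) n.-1.
Proof.
have [K KE Kdim] := scalar_kernel (sign_form a s).
exists (cross_vertex a (i0, s i0)), K; split.
- exact/sign_facet_vertex.
- move=> y /(sign_facetP s i0)[_ y1].
  by rewrite KE linearB /= y1 sign_form_vertex addbb subrr.
- move=> W FW; apply/subvP => y; rewrite KE => /eqP y0.
  (* The coefficients sum to [sign_form a s y], which is 0, so subtracting the base vertex in every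
     term leaves the sum unchanged. *)
  suff -> : y = \sum_i ((-1) ^+ s i * (a i)^-1 * y ord0 i) *:
      (cross_vertex a (i, s i) - cross_vertex a (i0, s i0)).
    by apply: memv_suml => i _; apply/memvZ/FW/sign_facet_vertex.
  under eq_bigr do rewrite scalerBr.
  rewrite sumrB -scaler_suml -[X in X *: _]/(sign_form a s y) y0 scale0r subr0.
  rewrite [LHS]row_sum_delta; apply: eq_bigr => i _; rewrite scalerA /=.
  by congr (_ *: _); case: (s i); rewrite ?expr0 ?expr1; field; rewrite gt_eqF.
- by apply: (Kdim (cross_vertex a (i0, s i0)));
    rewrite /= sign_form_vertex addbb oner_eq0.
Qed.

(** A facet contains exactly one vertex of each antipodal pair, and the choices made form the sign
    vector. *)
Let facet_sign F (i0 : 'I_n) : faces P n.-1 F -> exists s, F = sign_facet s.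
Proof.
move=> [fF [x0 [V [Fx0 FV Vmin Vdim]]]].
have n_gt0 : (0 < n)%N by case: (n) i0 => [[]|].
have subF y z : F y -> F z -> y - z \in V.
  move=> Fy Fz; have -> : y - z = (y - x0) - (z - x0) by rewrite opprB addrA subrK.
  by rewrite memvB// FV.
(* A form maximal at two opposite vertices is nonpositive on [P], hence zero at every vertex by
   symmetry; then [F] contains all vertices and has dimension n, not n - 1. *)
have noopp i : ~ (F (cross_vertex a (i, false)) /\ F (cross_vertex a (i, true))).
  move=> [Fp Fn]; have [l lE] := fF.
  have l_le k : l (cross_vertex a k) <= 0.
    have := P_vertex k; move: Fp Fn; rewrite lE => -[_ Fp] [_ Fn] Pk.
    have := cross_vertexN i false => /= e.
    by have := Fp _ Pk; have := Fn _ Pk; rewrite e linearN /=; lra.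
  have l0 k : l (cross_vertex a k) = 0.
    case: k => j b; have := l_le (j, b); have := l_le (j, ~~ b).
    by rewrite cross_vertexN linearN /=; lra.
  have Fv k : F (cross_vertex a k).
    rewrite lE; split=> // z [w [w0 w1 ->]]; rewrite l0 linear_sum big1// => j _.
    by have [k' ->] := xE j; rewrite linearZ /= l0 mulr0.
  have : (fullv <= V)%VS.
    apply/subvP => y _; rewrite [y]row_sum_delta; apply: memv_suml => j _.
    apply: memvZ; have := subF _ _ (Fv (j, false)) (Fv (j, true)).
    rewrite (cross_vertexN j false) opprK /cross_vertex /= expr0 mul1r -scalerDl.
    move=> /(memvZ (a j + a j)^-1); rewrite scalerA mulVf ?scale1r//.
    by rewrite gt_eqF// addr_gt0.
  move=> /dimvS; rewrite dimvf /dim /= mul1n Vdim => le_n.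
  by move: n_gt0; rewrite -(ltn_predL n) ltnNge le_n.
pose s : {ffun 'I_n -> bool} := [ffun i => `[< F (cross_vertex a (i, true)) >]].
have Fs i b : F (cross_vertex a (i, b)) -> b = s i.
  rewrite ffunE; case: b => Fb; first by symmetry; apply/asboolP.
  by symmetry; apply/asboolPn => Ft; exact: (noopp i).
exists s; suff sF i : F (cross_vertex a (i, s i)).
  apply: face_eq fF (sign_facet_face s) _ => i.
  have [[j b] ->] := xE i.
  by rewrite (sign_facet_vertex s j i0); split=> [/Fs|->].
apply: contrapT => nFi.
have [k Fk] := face_nonempty_gen fF Fx0; have [[j b] xk] := xE k.
move: Fk; rewrite xk => Fj; have bE := Fs _ _ Fj; rewrite bE in Fj.
have ij : i != j by apply: contra_notN nFi => /eqP ->.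
(* If F had no vertex on the i-th axis, flipping the sign of s at i would give
   a second supporting hyperplane containing F, too many for dimension n - 1. *)
have Vker (t : {ffun 'I_n -> bool}) :
      (forall i b, F (cross_vertex a (i, b)) -> b = t i) ->
    exists2 K : {vspace 'rV[R]_n},
      (forall y, (y \in K) = (sign_form a t y == 0)) & V = K.
  move=> Ft; have [K KE Kdim] := scalar_kernel (sign_form a t).
  have tF y : F y -> sign_form a t y = 1.
    move=> Fy; apply: ((sign_facetP t i0 _).1 _).2.
    apply: (face_le fF (sign_facet_face t)) Fy => k'.
    by have [[j' b'] ->] := xE k' => /Ft ->; apply/sign_facet_vertex.
  (* By minimality [V] lies in the kernel, and both have dimension n - 1. *)
  exists K => //; apply/eqP; rewrite -(dimv_leqif_eq _).2.
    rewrite Vdim (Kdim (cross_vertex a (i0, t i0)))//.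
    by rewrite /= sign_form_vertex addbb oner_eq0.
  by apply: Vmin => y Fy; rewrite KE linearB /= !tF// subrr.
pose t : {ffun 'I_n -> bool} := [ffun k => s k (+) (k == i)].
have Ft k' b' : F (cross_vertex a (k', b')) -> b' = t k'.
  move=> Fk; have b'E := Fs _ _ Fk; rewrite ffunE -b'E.
  by case: eqVneq Fk => [-> Fi|]; rewrite ?addbF//; case: nFi; rewrite -(Fs _ _ Fi).
have [K KE VK] := Vker s Fs; have [L LE VL] := Vker t Ft.
(* This difference is in the kernel for [s], but the form for [t] sends it to -1 - 1 = -2. *)
have := LE (cross_vertex a (i, s i) - cross_vertex a (j, s j)).
rewrite -VL VK KE !linearB /= !sign_form_vertex !addbb expr0 subrr eqxx.
rewrite !ffunE eqxx (eq_sym j) (negPf ij) addbF addbb addbT addNb addbb /=.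
by move=> /esym/eqP; lra.
Qed.

(** Facets correspond bijectively to sign vectors; [s] is recovered from the vertices [(i, s i)] of
    its facet. The family [x] may list a vertex several times, as a random sample does. *)
Lemma cross_polytope_nb_facets : (0 < n)%N -> nb_faces n.-1 P = (2 ^ n)%N.
Proof.
move=> n_gt0; have i0 : 'I_n := Ordinal n_gt0.
have facetsE : faces P n.-1 = sign_facet @` [set: {ffun 'I_n -> bool}].
  apply/seteqP; split=> [F /(facet_sign i0)[s ->]|F [s _ <-]]; first by exists s.
  by split; [exact: sign_facet_face|exact: sign_facet_dim].
have inj : injective sign_facet.
  move=> s t st; apply/ffunP => i.
  have : sign_facet s (cross_vertex a (i, s i)) by apply/sign_facet_vertex.
  by rewrite st => /(sign_facet_vertex t i i).
rewrite /nb_faces facetsE fset_set_image//; last exact: finite_finset.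
rewrite card_imfset//= -(card_uniqP (fset_uniq _)).
rewrite -[RHS](_ : #|{ffun 'I_n -> bool}| = _); last first.
  by rewrite card_ffun card_bool card_ord.
apply: eq_card => s; rewrite -[LHS]/(s \in fset_set _) in_fset_set.
  by rewrite mem_set.
exact: finite_finset.
Qed.

End cross_polytope.

(** * Borel sets of row vectors, sign changes of coordinates and rational points *)

Section borel_row_vectors.
Variables (R : realType) (n : nat).

Lemma open_measurable_rV (U : set 'rV[R]_n) :
  open U -> measurable (U : set (borel_rV R n)).
Proof. exact: sub_sigma_algebra. Qed.

Lemma closed_measurable_rV (U : set 'rV[R]_n) :
  closed U -> measurable (U : set (borel_rV R n)).
Proof.
move=> cU; rewrite -(setCK U); apply: measurableC.
by apply: open_measurable_rV; rewrite openC.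
Qed.

Lemma measurable_rV1 (x : borel_rV R n) : measurable [set x].
Proof.
apply: closed_measurable_rV; apply: accessible_closed_set1.
by apply: hausdorff_accessible; exact: norm_hausdorff.
Qed.

Lemma continuous_measurable_rV (f : 'rV[R]_n -> 'rV[R]_n) : continuous f ->
  measurable_fun setT (f : borel_rV R n -> borel_rV R n).
Proof.
move=> /continuousP cf; apply: (@measurability _ _ (borel_rV R n) (borel_rV R n) _ _ (@open _)) => //.
move=> _ [B oB <-].
rewrite setTI; apply: open_measurable_rV; exact: cf.
Qed.

Lemma measurable_coord i : measurable_fun setT (@coord R n i).
Proof.
apply: (measurability _ (RGenOpens.measurableE R)).
move=> _ [_ [a [b ->] <-]]; apply: measurableI => //.
apply: open_measurable_rV.
apply: (@open_comp _ _ (fun M : 'rV[R]_n => M ord0 i)); last exact: interval_open.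
by move=> M _; exact: coord_continuous.
Qed.

Definition flip (s : {ffun 'I_n -> bool}) (x : 'rV[R]_n) : 'rV[R]_n :=
  \row_i ((-1) ^+ s i * x ord0 i).

Lemma flip_continuous s : continuous (flip s).
Proof.
move=> x U /nbhs_ballP[e /= e0 eU]; apply/nbhs_ballP; exists e => //= y xy.
case: xy => _ xy; apply: eU; split=> // i j; rewrite !mxE ord1.
rewrite /ball /= -mulrBr normrM normr_sign mul1r.
exact: xy.
Qed.

Lemma measurable_flip s :
  measurable_fun setT (flip s : borel_rV R n -> borel_rV R n).
Proof. by apply: continuous_measurable_rV; exact: flip_continuous. Qed.

Lemma flipM s t x : flip s (flip t x) = flip [ffun i => s i (+) t i] x.
Proof. by apply/rowP => i; rewrite !mxE ffunE signr_addb mulrA. Qed.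

Lemma flipT x : flip [ffun=> true] x = - x.
Proof. by apply/rowP => i; rewrite !mxE ffunE expr1 mulN1r. Qed.

Lemma flip0 x : flip [ffun=> false] x = x.
Proof. by apply/rowP => i; rewrite !mxE ffunE expr0 mul1r. Qed.

(** An enumeration of the rational vectors, in which an integer that codes no vector is sent to the
    origin. *)
Definition rat_rV (k : nat) : 'rV[R]_n :=
  if choice.unpickle k is Some q then map_mx ratr (q : 'rV[rat]_n) else 0.

Lemma rat_rV_dense (U : set 'rV[R]_n) x : open U -> U x ->
  exists k, U (rat_rV k).
Proof.
move=> oU Ux; have /nbhs_ballP[e /= e0 eU] : nbhs x U by exact: open_nbhs_nbhs.
have /choice[q qP] : forall j : 'I_n, exists q : rat,
    ratr q \in `]x ord0 j - e, x ord0 j + e[.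
  by move=> j; apply: rat_in_itvoo; lra.
exists (choice.pickle (\row_j q j : 'rV[rat]_n)); rewrite /rat_rV choice.pickleK.
apply: eU; split=> // i j; rewrite !mxE ord1 /ball /= distrC ltr_distl.
by have := qP j; rewrite in_itv.
Qed.

End borel_row_vectors.

(** * Pushforwards, finite sums and series of measures *)

Section combining_measures.
Local Open Scope ereal_scope.
Context d (T : measurableType d) (R : realType).

Lemma pushforward_measure (m : {measure set T -> \bar R}) (f : T -> T) :
  measurable_fun setT f ->
  exists m' : {measure set T -> \bar R}, m' = pushforward m f :> (set T -> \bar R).
Proof. by move=> mf; unshelve eexists (pushforward m f). Qed.

(** Normalizing divides by the total mass 1, so it changes no value and only adds the probability
    structure. *)
Lemma measure_probability (m : {measure set T -> \bar R}) : m setT = 1 ->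
  exists P : probability T R, P = m :> (set T -> \bar R).
Proof.
move=> m1; exists (mnormalize m point); apply/funext => A.
transitivity (mnormalize m point A) => //; rewrite /mnormalize m1.
by rewrite onee_eq0 /= invr1 mule1.
Qed.

Lemma finsum_measure (I : finType) (m_ : I -> {measure set T -> \bar R}) :
  exists m : {measure set T -> \bar R},
    (forall A, m A = \sum_i m_ i A) /\
    forall f : T -> \bar R, (forall x, 0 <= f x) -> measurable_fun setT f ->
      \int[m]_x f x = \sum_i \int[m_ i]_x f x.
Proof.
(* [msum] runs over natural numbers, so [I] is enumerated and the zero measure fills the indices
   beyond its cardinality. *)
pose mk (k : nat) : {measure set T -> \bar R} :=
  if insub k is Some j then m_ (enum_val (j : 'I_#|I|)) else mzero.
have sumE (F : {measure set T -> \bar R} -> \bar R) :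
    \sum_(k < #|I|) F (mk k) = \sum_i F (m_ i).
  transitivity (\sum_(i in I) F (m_ i)); last by apply: eq_bigl.
  by rewrite [RHS]big_enum_val; apply: eq_bigr => j _; rewrite /mk valK.
exists (msum mk #|I|); split=> [A|f f0 mf]; first exact: (sumE (fun m => m A)).
by rewrite ge0_integral_measure_sum// (sumE (fun m => \int[m]_x f x)).
Qed.

Lemma mseries_dirac (w : nat -> R) (p : nat -> T) : (forall k, (0 <= w k)%R) ->
  exists m : {measure set T -> \bar R},
    (forall A, m A = \sum_(k <oo) (w k * \1_A (p k))%:E) /\
    forall f : T -> R, (forall x, 0 <= f x)%R -> measurable_fun setT f ->
      \int[m]_x (f x)%:E = \sum_(k <oo) (w k * f (p k))%:E.
Proof.
move=> w0; pose m_ k : {measure set T -> \bar R} :=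
  mscale (NngNum (w0 k)) (dirac (p k)).
exists (mseries m_ 0); split=> [A //|f f0 mf].
have mf' : measurable_fun setT (EFin \o f) by exact/measurable_EFinP.
rewrite ge0_integral_measure_series//; last by move=> x _; rewrite lee_fin.
apply: eq_eseriesr => k _; rewrite ge0_integral_mscale//; last first.
  by move=> x _; rewrite lee_fin.
by rewrite integral_dirac// diracT mul1e.
Qed.

End combining_measures.

(** * A small measure of full support *)

Section full_support.
Local Open Scope ereal_scope.
Variables (R : realType) (n : nat).

Lemma small_full_measure (e : R) : (0 < e)%R ->
  exists m : {measure set (borel_rV R n) -> \bar R},
    [/\ m setT <= e%:E,
        forall i, \int[m]_x (coord i x ^+ 2)%:E <= e%:E &
        forall (U : set 'rV[R]_n) x, open U -> U x -> 0 < m U].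
Proof.
move=> e0; pose q := @rat_rV R n.
(* [D k] dominates both 1 and each squared coordinate of the k-th point. Dividing the geometric
   weights by it lets [bound] control the mass and the second moments at once. *)
pose D k := (1 + \sum_i q k ord0 i ^+ 2)%R.
have D1 k : (1 <= D k)%R by rewrite lerDl sumr_ge0// => i _; exact: sqr_ge0.
have D0 k : (0 < D k)%R by exact: lt_le_trans (D1 k).
pose w k : R := (e / (2 ^ k.+1)%:R / D k)%R.
have w0 k : (0 < w k)%R by rewrite !divr_gt0// ltr0n expn_gt0.
have [m [mE mf]] := @mseries_dirac _ (borel_rV R n) _ w q (fun k => ltW (w0 k)).
have bound (f : nat -> R) : (forall k, 0 <= f k <= D k)%R ->
    \sum_(k <oo) (w k * f k)%:E <= e%:E.
  move=> fD; apply: le_trans (epsilon_trick0 xpredT (ltW e0)).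
  apply: lee_nneseries => [k _ _|k _]; rewrite lee_fin.
    by rewrite mulr_ge0 ?(ltW (w0 k))//; case/andP: (fD k).
  rewrite /w mulrAC -mulrA ler_piMr//.
    by rewrite divr_ge0 ?(ltW e0).
  by rewrite ler_pdivrMr ?mul1r//; case/andP: (fD k).
exists m; split.
- rewrite mE; apply: bound => k.
  by rewrite indicE mem_set//= ler01 D1.
- move=> i; rewrite mf; last 2 first.
  + by move=> x; exact: sqr_ge0.
  + by apply: measurable_funX; exact: measurable_coord.
  apply: bound => k; rewrite sqr_ge0 /= /D (bigD1 i)//= addrCA lerDl.
  by rewrite addr_ge0// sumr_ge0// => j _; exact: sqr_ge0.
- move=> U x oU Ux; have [k Uk] := rat_rV_dense oU Ux.
  rewrite mE; apply: lt_le_trans (nneseries_lim_ge k.+1 _) => /=; last first.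
    by move=> j _ _; rewrite lee_fin mulr_ge0// ltW.
  rewrite big_mkord big_ord_recr /=; apply: (@lt_le_trans _ _ (w k)%:E).
    by rewrite lte_fin.
  rewrite indicE mem_set// mulr1 leeDr// sume_ge0// => j _.
  by rewrite lee_fin mulr_ge0// ltW.
Qed.

End full_support.

(** * Measures invariant under sign changes of coordinates *)

Section flip_invariance.
Local Open Scope ereal_scope.
Variables (R : realType) (n : nat).
Variable nu : probability (borel_rV R n) R.
Hypothesis nu_flip : forall s A, nu (flip s @^-1` A) = nu A.

Lemma flip_invariant_symmetric : symmetric_measure nu.
Proof.
move=> A _; rewrite -[RHS](nu_flip [ffun=> true]); congr (nu _).
by apply/seteqP; split=> x /=; rewrite flipT.
Qed.

(** The change of variables [flip s] shows that the integral equals its own opposite; it is finite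
    by integrability. *)
Lemma odd_integral s (f : borel_rV R n -> R) :
  nu.-integrable setT (EFin \o f) -> (forall x, f (flip s x) = - f x)%R ->
  \int[nu]_x (f x)%:E = 0.
Proof.
move=> fi fN; have mf := measurable_int _ fi.
have fi' : nu.-integrable setT ((EFin \o f) \o flip s).
  apply: eq_integrable (integrableN fi) => // x _ /=.
  by rewrite fN EFinN.
have e : \int[nu]_x (f x)%:E = - \int[nu]_x (f x)%:E.
  transitivity (\int[@pushforward _ _ (borel_rV R n) (borel_rV R n) R nu (flip s)]_x (f x)%:E).
    by congr (integral _ _ _); apply/funext => A; exact/esym/nu_flip.
  rewrite (integral_pushforward (measurable_flip s) mf)//=.
  under eq_integral do rewrite fN EFinN.
  by apply: (@integralN _ _ _ nu setT (EFin \o f)); exact: integrable_add_def.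
have := integrable_fin_num measurableT fi; move: e => /=.
by case: (\int[nu]_x _) => //= r [] rN _; congr EFin; lra.
Qed.

Hypothesis nu_sqr : forall i, \int[nu]_x (coord i x ^+ 2)%:E = 1.

(** Flipping coordinate i makes [coord i] odd, and also its product with any other coordinate, so
    means and off-diagonal covariances vanish; [nu_sqr] gives the diagonal. *)
Lemma flip_invariant_isotropic : isotropic nu.
Proof.
have mc (i : 'I_n) := @measurable_coord R n i.
have sqr_int i : nu.-integrable setT (fun x => (coord i x ^+ 2)%:E).
  apply/integrableP; split; first by apply/measurable_EFinP/measurable_funX.
  under eq_integral do rewrite gee0_abs ?lee_fin ?sqr_ge0//.
  by rewrite nu_sqr ltry.
have coord_int i : nu.-integrable setT (EFin \o coord i).
  (* Domination by |t| <= 1 + t^2, and for products below by |st| <= s^2 + t^2. *)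
  apply: le_integrable (integrableD measurableT
    (finite_measure_integrable_cst nu 1 measurableT) (sqr_int i)) => //.
    by apply/measurable_EFinP.
  move=> x _ /=; rewrite lee_fin (ger0_norm (addr_ge0 _ (sqr_ge0 _)))//.
  rewrite -(real_normK (num_real (coord i x))).
  by have := sqr_ge0 (`|coord i x| - 1)%R; have := normr_ge0 (coord i x); nra.
have prod_int i j : nu.-integrable setT (fun x => (coord i x * coord j x)%:E).
  apply: le_integrable (integrableD measurableT (sqr_int i) (sqr_int j)) => //.
    by apply/measurable_EFinP/measurable_funM.
  move=> x _ /=; rewrite lee_fin (ger0_norm (addr_ge0 (sqr_ge0 _) (sqr_ge0 _)))//.
  rewrite normrM -(real_normK (num_real (coord i x))).
  rewrite -(real_normK (num_real (coord j x))).
  have := sqr_ge0 (`|coord i x| - `|coord j x|)%R.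
  by have := mulr_ge0 (normr_ge0 (coord i x)) (normr_ge0 (coord j x)); nra.
pose s (i : 'I_n) : {ffun 'I_n -> bool} := [ffun k => k == i].
have flip_coord i j x : coord j (flip (s i) x) = ((-1) ^+ (j == i) * coord j x)%R.
  by rewrite /coord mxE ffunE.
have mean0 i : 'E_nu[coord i] = 0.
  rewrite unlock; apply: (@odd_integral (s i)) => // x.
  by rewrite flip_coord eqxx expr1 mulN1r.
have cov i j : covariance nu (coord i) (coord j) =
    \int[nu]_x (coord i x * coord j x)%:E.
  rewrite unlock !mean0 unlock; apply: eq_integral => x _ /=.
  by rewrite -[LHS]/((coord i x - 0) * (coord j x - 0))%:E !subr0.
split=> // i j; rewrite cov.
have [<-|ij] := eqVneq i j.
  by rewrite -[RHS](nu_sqr i).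
apply: (@odd_integral (s i) (fun x => coord i x * coord j x)%R).
  exact: prod_int.
by move=> x; rewrite !flip_coord eqxx eq_sym (negPf ij) expr1 expr0; lra.
Qed.

End flip_invariance.

(** * The isotropic measure concentrated near the vertices of a cross-polytope *)

Section cross_measure.
Local Open Scope ereal_scope.
Variables (R : realType) (n : nat).

Lemma flip_vertex (a : 'I_n -> R) s i b :
  flip s (cross_vertex a (i, b)) = cross_vertex a (i, s i (+) b).
Proof.
apply/rowP => j; rewrite !mxE /=; have [->|ji] := eqVneq j i.
  by rewrite signr_addb !mulrA.
by rewrite !mulr0.
Qed.

Lemma flipK (s : {ffun 'I_n -> bool}) : involutive (@flip R n s).
Proof.
by move=> x; rewrite flipM; apply/rowP => i; rewrite !mxE ffunE addbb mul1r.
Qed.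

Lemma measurable_vertices (a : 'I_n -> R) :
  measurable (range (cross_vertex a) : set (borel_rV R n)).
Proof.
rewrite -[range _]bigcup_imset1; apply: fin_bigcup_measurable.
  exact: finite_finset.
by move=> k _; exact: measurable_rV1.
Qed.

(** The measure is the sum over all sign changes of the images of [m1], which adds to a small
    measure [m0] of full support equal atoms on the positive half-axes. *)
Lemma cross_measure (e : R) : (0 < n)%N -> (0 < e < (4 * n%:R)^-1)%R ->
  exists (nu : probability (borel_rV R n) R) (a : 'I_n -> R),
    [/\ forall i, (0 < a i)%R,
        symmetric_measure nu, isotropic nu, measure_support nu = setT &
        (forall k, ((4 * n%:R)^-1)%:E <= nu [set cross_vertex a k]) /\
        nu (~` range (cross_vertex a)) <= e%:E].
Proof.
move=> n_gt0 /andP[e0 en]; pose S := {ffun 'I_n -> bool}.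
have n0 : (0 < n%:R :> R)%R by rewrite ltr0n.
have e4 : (e < 4^-1)%R.
  apply: lt_le_trans en _; rewrite lef_pV2 ?posrE ?mulr_gt0//.
  by rewrite ler_peMr// ler1n.
(* [h] is the share of each of the 2^n sign changes: [m1] gets total mass and second moments [h], so
   the sum has total mass and second moments 1. *)
pose h : R := ((2 ^+ n)^-1)%R; have h0 : (0 < h)%R by rewrite invr_gt0 exprn_gt0.
have sumS (r : R) : \sum_(s : S) r%:E = (2 ^+ n * r)%:E.
  rewrite sumEFin sumr_const card_ffun card_bool card_ord -natrX.
  by rewrite mulr_natl.
have h2 : (2 ^+ n * h = 1)%R by rewrite mulfV// expf_neq0.
have eh0 : (0 < e * h)%R by rewrite mulr_gt0.
have [m0 [m0T m0sq m0U]] := small_full_measure n eh0.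
have [eta m0E] : exists eta, m0 setT = eta%:E.
  exists (fine (m0 setT)); rewrite fineK// ge0_fin_numE//.
  exact: le_lt_trans m0T (ltry _).
have {}m0T : (0 <= eta <= e * h)%R by rewrite -2!lee_fin -m0E measure_ge0.
have sq_ge0 i (x : borel_rV R n) : 0 <= (coord i x ^+ 2)%:E.
  by rewrite lee_fin sqr_ge0.
have msq i : measurable_fun setT (fun x : borel_rV R n => (coord i x ^+ 2)%:E).
  by apply/measurable_EFinP/measurable_funX; exact: measurable_coord.
have /choice[tau tauE] : forall i, exists t : R,
    \int[m0]_x (coord i x ^+ 2)%:E = t%:E.
  move=> i; exists (fine (\int[m0]_x (coord i x ^+ 2)%:E)).
  rewrite fineK// ge0_fin_numE; last by apply: integral_ge0 => x _; exact: sq_ge0.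
  exact: le_lt_trans (m0sq i) (ltry _).
have {m0sq} tau_le i : (tau i <= e * h)%R by rewrite -lee_fin -tauE.
(* The mass left over by [m0] is split equally among the n atoms; [a i] then solves c a_i^2 + tau_i
   = h, the second-moment condition. *)
pose c : R := ((h - eta) / n%:R)%R.
have c0 : (0 < c)%R by rewrite divr_gt0//; nra.
pose a i : R := Num.sqrt ((h - tau i) / c)%R.
have a2_gt0 i : (0 < (h - tau i) / c)%R.
  by rewrite divr_gt0//; have := tau_le i; nra.
have a0 i : (0 < a i)%R by rewrite sqrtr_gt0.
have a2 i : (c * a i ^+ 2 = h - tau i)%R.
  by rewrite sqr_sqrtr ?ltW// mulrC divfK// gt_eqF.
pose v (i : 'I_n) : borel_rV R n := cross_vertex a (i, false).
have [mc [mcE mcf]] := finsum_measure (fun i : 'I_n =>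
  mscale (NngNum (ltW c0)) (dirac (v i))).
pose m1 := measure_add m0 mc.
have m1T : m1 setT = h%:E.
  rewrite /m1 measure_addE mcE m0E.
  under eq_bigr do rewrite /= /mscale /= diracT mule1.
  rewrite sumEFin sumr_const card_ord -EFinD -mulr_natl /c mulrCA.
  by rewrite mulfV ?gt_eqF// mulr1 addrC subrK.
have m1sq i : \int[m1]_x (coord i x ^+ 2)%:E = h%:E.
  rewrite /m1 ge0_integral_measure_add// mcf// tauE.
  under eq_bigr => j _.
    rewrite ge0_integral_mscale// integral_dirac// diracT mul1e /=.
    over.
  rewrite sumEFin -EFinD (bigD1 i)//= big1 ?addr0.
    by rewrite /coord !mxE !eqxx mulr1 mul1r a2 addrC subrK.
  by move=> j ji; rewrite /coord !mxE eq_sym (negPf ji) andbF mulr0 expr0n mulr0.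
have /choice[pf pfE] := fun s => pushforward_measure m1 (@measurable_flip R n s).
have [M [ME Mf]] := finsum_measure pf.
have [nu nuM] : exists nu : probability (borel_rV R n) R,
    nu = M :> (set (borel_rV R n) -> \bar R).
  apply: measure_probability; rewrite ME.
  transitivity (\sum_(s : S) h%:E); last by rewrite sumS h2.
  by apply: eq_bigr => s _; rewrite pfE; exact: m1T.
have nuE A : nu A = \sum_(s : S) m1 (flip s @^-1` A).
  by rewrite nuM ME; apply: eq_bigr => s _; rewrite pfE.
(* Composition with [flip t] only permutes the sign changes in the sum. *)
have nu_flip t A : nu (flip t @^-1` A) = nu A.
  pose st (s : S) : S := [ffun i => t i (+) s i].
  have stK : involutive st by move=> s; apply/ffunP => i; rewrite !ffunE addKb.
  rewrite !nuE [RHS](reindex_inj (inv_inj stK)); apply: eq_bigr => s _.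
  by congr (m1 _); apply/seteqP; split=> x /=; rewrite flipM.
have nu_sqr i : \int[nu]_x (coord i x ^+ 2)%:E = 1.
  rewrite nuM Mf// -[RHS]/(1%R%:E) -h2 -sumS; apply: eq_bigr => s _.
  rewrite pfE ge0_integral_pushforward//; last exact: measurable_flip.
  rewrite preimage_setT -[RHS](m1sq i); apply: eq_integral => x _ /=.
  by rewrite /coord mxE exprMn sqrr_sign mul1r.
have nu_m1 A : m1 A <= nu A.
  have id_pre : flip [ffun=> false] @^-1` A = A.
    by apply/seteqP; split=> x /=; rewrite flip0.
  by rewrite nuE (bigD1 [ffun=> false])//= id_pre leeDl// sume_ge0.
exists nu, a; split.
- exact: a0.
- exact: flip_invariant_symmetric.
- exact: flip_invariant_isotropic.
- rewrite -subTset => x _ U oU Ux; apply: lt_le_trans (nu_m1 U).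
  apply: (@lt_le_trans _ _ (m0 U)); first exact: m0U Ux.
  by rewrite /m1 measure_addE leeDl.
split=> [[i b]|].
  have nuN : nu [set cross_vertex a (i, ~~ b)] = nu [set cross_vertex a (i, b)].
    rewrite -(nu_flip [ffun=> true]); congr (nu _); apply/seteqP.
    by split=> x /=; rewrite flipT cross_vertexN; [move=> /oppr_inj|move=> ->].
  have m1v j : c%:E <= m1 [set v j].
    rewrite /m1 measure_addE mcE (bigD1 j)//=.
    rewrite /mscale /= diracE mem_set// mule1 addeCA leeDl// adde_ge0//.
    by apply: sume_ge0 => k _; rewrite mule_ge0// lee_fin ltW.
  (* Each sign change carries the i-th atom to one of the two opposite vertices. These have equal
     mass, so each has at least 2^n c / 2 >= (1 - e) / (2n), which exceeds 1 / (4n) since e <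
     1/4. *)
  have : \sum_(s : S) c%:E <=
      nu [set cross_vertex a (i, b)] + nu [set cross_vertex a (i, ~~ b)].
    rewrite !nuE -big_split; apply: lee_sum => s _ /=.
    have pre : flip s @^-1` [set cross_vertex a (i, s i)] = [set v i].
      apply/seteqP; split=> x /= [].
        by move=> e'; rewrite -(flipK s x) e' flip_vertex addbb.
      by move=> ->; rewrite flip_vertex addbF.
    have -> : c%:E = c%:E + 0 by rewrite adde0.
    case: (eqVneq (s i) b) => [<-|sb].
      by rewrite leeD// pre.
    have <- : s i = ~~ b by move: sb; case: (s i); case: (b).
    by rewrite addeC leeD// pre.
  rewrite nuN sumS.
  have nufin : nu [set cross_vertex a (i, b)] \is a fin_num.
    by apply: fin_num_measure; exact: measurable_rV1.
  rewrite -(fineK nufin) -EFinD !lee_fin => le_nu.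
  suff : (2 * (4 * n%:R)^-1 <= 2 ^+ n * c)%R by move: le_nu; lra.
  have -> : (2 * (4 * n%:R)^-1 = 2^-1 / n%:R :> R)%R by field; rewrite gt_eqF.
  rewrite /c mulrA mulrBr h2 ler_pM2r ?invr_gt0//.
  have : (2 ^+ n * eta <= 2 ^+ n * (e * h))%R.
    by rewrite ler_pM2l ?exprn_gt0//; case/andP: m0T.
  by rewrite mulrCA h2; lra.
(* Off the vertices only the images of [m0] contribute, each at most [e * h]. *)
rewrite nuE -[e]mul1r -h2 -mulrA -sumS; apply: lee_sum => s _.
rewrite /m1 measure_addE mcE big1 ?adde0; last first.
  move=> j _; rewrite /= /mscale /= diracE memNset ?mule0//= flip_vertex.
  by apply; exists (j, s j (+) false).
apply: (@le_trans _ _ (m0 setT)).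
  apply: le_measure; rewrite ?inE//.
  rewrite -[X in measurable X]setTI; apply: measurable_flip => //.
  by apply: measurableC; exact: measurable_vertices.
by rewrite m0E lee_fin mulrC; case/andP: m0T; lra.
Qed.

End cross_measure.

(** * Monotonicity of integrals and a finite union bound *)

Section integral_monotone.
Local Open Scope ereal_scope.
Context d (T : measurableType d) (R : realType).
Variable mu : {measure set T -> \bar R}.

(* The integral of a nonnegative function is a supremum over the simple
   functions below it, whence no measurability assumption. *)
Lemma le_integral_nonmeasurable (f g : T -> \bar R) :
  (forall x, 0 <= f x) -> (forall x, f x <= g x) ->
  \int[mu]_x f x <= \int[mu]_x g x.
Proof.
move=> f0 fg; rewrite !ge0_integralE//; last first.
  by move=> x _; exact: le_trans (fg x).
apply: le_ereal_sup => _ [h hf <-]; exists h => // x.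
by apply: le_trans (hf x) _; rewrite !patch_setT.
Qed.

Lemma measure_fin_bigcup_le (I : finType) (A : I -> set T) :
  (forall i, measurable (A i)) -> mu (\bigcup_i A i) <= \sum_i mu (A i).
Proof.
move=> mA; have -> : \bigcup_i A i = \big[setU/set0]_(i <- enum I) A i.
  by rewrite -bigcup_seq; apply: eq_bigcupl; split=> i //= _; rewrite mem_enum.
rewrite -big_enum; elim: (enum I) => [|i s IH].
  by rewrite !big_nil measure0.
rewrite !big_cons; apply: le_trans (leeD2l _ IH).
by apply: measureU2 => //; exact: bigsetU_measurable.
Qed.

End integral_monotone.

(** * Bounds on the expected number of facets *)

Section expected_facets.
Variables (R : realType) (n N : nat) (nu : probability (borel_rV R n) R).
Variables (a : 'I_n -> R) (p e : R).
Hypotheses (n_gt0 : (0 < n)%N) (a_gt0 : forall i, 0 < a i).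

Hypothesis nu_vertex : forall k, (p%:E <= nu [set cross_vertex a k])%E.
Hypothesis nu_other : (nu (~` range (cross_vertex a)) <= e%:E)%E.
Context d (Omega : measurableType d) (P : probability Omega R).
Variable X : 'I_N -> {RV P >-> borel_rV R n}.
Hypothesis X_iid : iid_sample nu X.

Let V := range (cross_vertex a) : set (borel_rV R n).

Let nb w := nb_faces n.-1 (conv_hull (fun i => X i w : 'rV[R]_n)).

Let missed : set Omega :=
  \bigcup_k \bigcap_i X i @^-1` ~` [set cross_vertex a k].

Let outside : set Omega := \bigcup_i X i @^-1` ~` V.

Let mpre (B : set (borel_rV R n)) i : measurable B -> measurable (X i @^-1` B).
Proof. by move=> mB; rewrite -[X in measurable X]setTI; exact: measurable_funPT. Qed.

Let mmiss k : measurable (\bigcap_i X i @^-1` ~` [set cross_vertex a k]).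
Proof.
apply: fin_bigcap_measurable; first exact: finite_finset.
by move=> i _; apply: mpre; apply: measurableC; exact: measurable_rV1.
Qed.

Let mmissed : measurable missed.
Proof. by apply: fin_bigcup_measurable => //; exact: finite_finset. Qed.

Let mout i : measurable (X i @^-1` ~` V).
Proof. by apply: mpre; apply: measurableC; exact: measurable_vertices. Qed.

Let moutside : measurable outside.
Proof. by apply: fin_bigcup_measurable => //; exact: finite_finset. Qed.

(** The coupon-collector bound: a union over the 2n vertices, each missed by N independent points
    with probability at most (1 - p)^N. *)
Let P_missed : (P missed <= ((2 * n)%:R * (1 - p) ^+ N)%:E)%E.
Proof.
apply: le_trans (measure_fin_bigcup_le _ mmiss) _.
apply: (@le_trans _ _ (\sum_(k : 'I_n * bool) ((1 - p) ^+ N)%:E)%E); last first.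
  by rewrite sumEFin sumr_const card_prod card_bool card_ord mulr_natl mulnC.
apply: lee_sum => k _; have [indep distr] := X_iid.
have mC : measurable (~` [set (cross_vertex a k : borel_rV R n)]).
  by apply: measurableC; exact: measurable_rV1.
pose A : set (borel_rV R n) := ~` [set cross_vertex a k].
suff : (P (\bigcap_i X i @^-1` A) <= ((1 - p) ^+ N)%:E)%E by [].
have -> : P (\bigcap_i X i @^-1` A) =
    (\prod_(i in [set: 'I_N]%SET) P (X i @^-1` A))%E.
  rewrite -(indep [set: 'I_N]%SET (fun=> A) (fun=> mC)); congr (P _).
  by apply: eq_bigcapl; split=> i //= _; rewrite finset.in_setT.
have [nuk nuk1 pr] : exists2 r, nu [set cross_vertex a k] = r%:E & p <= r.
  exists (fine (nu [set cross_vertex a k])).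
    by rewrite fineK// fin_num_measure//; exact: measurable_rV1.
  by rewrite -lee_fin fineK ?nu_vertex// fin_num_measure//; exact: measurable_rV1.
have PE i : P (X i @^-1` A) = (1 - nuk)%:E.
  rewrite -[LHS]/(distribution P (X i) _) distr// probability_setC ?nuk1//.
  exact: measurable_rV1.
have r1 : nuk <= 1 by rewrite -lee_fin -nuk1; apply: probability_le1; exact: measurable_rV1.
under eq_bigr do rewrite PE.
rewrite prodEFin lee_fin prodr_const cardsT card_ord.
by rewrite lerXn2r// ?nnegrE; lra.
Qed.

Let P_outside : (P outside <= (N%:R * e)%:E)%E.
Proof.
apply: le_trans (measure_fin_bigcup_le _ mout) _.
apply: (@le_trans _ _ (\sum_(i < N) e%:E)%E); last first.
  by rewrite sumEFin sumr_const card_ord mulr_natl.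
apply: lee_sum => i _; have [_ distr] := X_iid.
rewrite -[leLHS]/(distribution P (X i) _) distr//.
by apply: measurableC; exact: measurable_vertices.
Qed.

Let nb_generic w : ~ missed w -> ~ outside w -> nb w = (2 ^ n)%N.
Proof.
move=> mw ow; apply: cross_polytope_nb_facets => // [i|k].
  apply: contrapT => nX; apply: ow; exists i => // -[k _ kX].
  by apply: nX; exists k.
apply: contrapT => nX; apply: mw; exists k => // i _ Xk.
by apply: nX; exists i.
Qed.

Let nb_inside w : ~ outside w -> (nb w <= 4 ^ n)%N.
Proof.
move=> ow; have -> : (4 ^ n = 2 ^ #|{: 'I_n * bool}|)%N.
  by rewrite card_prod card_bool card_ord mulnC expnM.
apply: (nb_faces_le (v := cross_vertex a)) => i.
apply: contrapT => nX; apply: ow; exists i => // -[k _ kX].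
by apply: nX; exists k.
Qed.

Let nb_all w : (nb w <= 2 ^ N)%N.
Proof.
rewrite -[X in (2 ^ X)%N]card_ord; apply: (nb_faces_le (v := fun i => X i w)).
by move=> i; exists i.
Qed.

Let miss := (2 * n)%:R * (1 - p) ^+ N.

(** The facet count lies pointwise between 2^n times the indicator of the good event [G] and 2^n +
    4^n 1_missed + 2^N 1_outside; integrating gives both bounds. *)
Lemma expected_facets : exists2 r : R, ('E_P[fun w => (nb w)%:R] = r%:E)%E &
  2 ^+ n * (1 - miss - N%:R * e) <= r <= 2 ^+ n + 4 ^+ n * miss + 2 ^+ N * (N%:R * e).
Proof.
pose G := ~` (missed `|` outside).
have mG : measurable G by apply/measurableC/measurableU.
have mindic (A : set Omega) (c : R) : measurable A ->
    measurable_fun setT (fun w => (c * \1_A w)%:E).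
  by move=> mA; apply/measurable_EFinP/measurable_funM.
have iindic (A : set Omega) (c : R) : measurable A -> 0 <= c ->
    (\int[P]_w (c * \1_A w)%:E = c%:E * P A)%E.
  move=> mA c0; under eq_integral do rewrite EFinM.
  rewrite ge0_integralZl_EFin//; first by rewrite integral_indic// setIT.
  exact/measurable_EFinP.
have lo : ((2 ^+ n)%:E * P G <= 'E_P[fun w => (nb w)%:R])%E.
  rewrite -iindic// unlock; apply: le_integral_nonmeasurable => w.
    by rewrite lee_fin mulr_ge0.
  rewrite lee_fin indicE; case: (boolP (w \in G)); last by rewrite mulr0.
  by rewrite inE mulr1 => /not_orP[mw ow]; rewrite nb_generic// natrX.
have hi : ('E_P[fun w => (nb w)%:R] <=
    (2 ^+ n)%:E + (4 ^+ n)%:E * P missed + (2 ^+ N)%:E * P outside)%E.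
  have -> : ((2 ^+ n)%:E + (4 ^+ n)%:E * P missed + (2 ^+ N)%:E * P outside =
      \int[P]_w ((2 ^+ n * \1_setT w)%:E + (4 ^+ n * \1_missed w)%:E +
        (2 ^+ N * \1_outside w)%:E))%E.
    have nn (A : set Omega) (c : R) w : 0 <= c -> (0 <= (c * \1_A w)%:E)%E.
      by move=> c0; rewrite lee_fin mulr_ge0.
    have intD (f g : Omega -> \bar R) : (forall w, 0 <= f w)%E ->
        measurable_fun setT f -> (forall w, 0 <= g w)%E -> measurable_fun setT g ->
        (\int[P]_w (f w + g w) = \int[P]_w f w + \int[P]_w g w)%E.
      by move=> f0 mf g0 mg; rewrite ge0_integralD.
    rewrite intD; [rewrite intD| | | |].
    - by rewrite !iindic// probability_setT mule1.
    - by move=> w; exact: nn.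
    - exact: mindic.
    - by move=> w; exact: nn.
    - exact: mindic.
    - by move=> w; rewrite adde_ge0// nn.
    - by apply: emeasurable_funD; exact: mindic.
    - by move=> w; exact: nn.
    - exact: mindic.
  rewrite unlock; apply: le_integral_nonmeasurable => w; first by rewrite lee_fin.
  rewrite -!EFinD lee_fin !indicE in_setT mulr1.
  have [ow|ow] := boolP (w \in outside).
    rewrite mulr1 -[leLHS]add0r lerD ?addr_ge0 ?mulr_ge0//.
    by rewrite -natrX ler_nat.
  rewrite mulr0 addr0; have {}ow : ~ outside w by move/negP: ow; rewrite inE.
  have [mw|mw] := boolP (w \in missed).
    by rewrite mulr1 -[leLHS]add0r lerD// -natrX ler_nat nb_inside.
  have {}mw : ~ missed w by move/negP: mw; rewrite inE.
  by rewrite mulr0 addr0 nb_generic// natrX.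
have [pm pmE] : exists pm, P missed = pm%:E.
  by exists (fine (P missed)); rewrite fineK// fin_num_measure.
have [po poE] : exists po, P outside = po%:E.
  by exists (fine (P outside)); rewrite fineK// fin_num_measure.
have pG : ((1 - pm - po)%:E <= P G)%E.
  rewrite probability_setC; last exact: measurableU.
  have : (P (missed `|` outside) <= P missed + P outside)%E.
    exact: measureU2.
  have [pu ->] : exists pu, P (missed `|` outside) = pu%:E.
    exists (fine (P (missed `|` outside))); rewrite fineK// fin_num_measure//.
    exact: measurableU.
  by rewrite pmE poE -EFinD -EFinB !lee_fin; lra.
have e2n : 0 <= 2 ^+ n :> R by rewrite exprn_ge0.
have e4n : 0 <= 4 ^+ n :> R by rewrite exprn_ge0.
have e2N : 0 <= 2 ^+ N :> R by rewrite exprn_ge0.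
move: P_missed P_outside hi lo; rewrite pmE poE !lee_fin -!EFinM -!EFinD.
(* The upper bound excludes the value +oo and the lower bound excludes -oo. *)
move: ('E_P[_])%E => [r| |] // pm_le po_le; last first.
  by move=> _; rewrite leeNy_eq -(fineK (fin_num_measure P G mG)).
rewrite lee_fin => hi lo; exists r => //; apply/andP; split; last first.
  apply: (le_trans hi); rewrite lerD// ?lerD2l; exact: ler_wpM2l.
have : ((2 ^+ n * (1 - pm - po))%:E <= r%:E)%E.
  by apply: le_trans lo; rewrite EFinM lee_wpmul2l.
rewrite lee_fin; apply: le_trans; rewrite ler_wpM2l//.
by rewrite /miss; lra.
Qed.

End expected_facets.

(** * Asymptotic estimates *)

Section asymptotics.
Variable R : realType.

Lemma exprn2_le_expR n : 2 ^+ n <= expR n%:R :> R.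
Proof.
rewrite -[n%:R]mulr1 expRM_natl lerXn2r ?nnegrE ?expR_ge0//.
by have := expR_ge1Dx (1 : R); lra.
Qed.

Lemma exprB_le_expRN (p : R) N : p <= 1 -> (1 - p) ^+ N <= expR (- (N%:R * p)).
Proof.
move=> p1; rewrite -mulrN expRM_natl lerXn2r ?nnegrE ?expR_ge0 ?subr_ge0//.
exact: expR_ge1Dx.
Qed.

Lemma expRX_lower k (x : R) : 0 <= x -> x ^+ k <= expR (k%:R * x).
Proof.
move=> x0; rewrite expRM_natl lerXn2r ?nnegrE ?expR_ge0//.
by have := expR_ge1Dx x; lra.
Qed.

(** From e^y >= (y / 3)^3 at y = alpha n, a cubic in n. The constant 12 is what makes N / (4n) at
    least 3n. *)
Lemma sample_size_superquadratic (alpha : R) : 0 < alpha ->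
  \forall n \near \oo, 12 * n%:R ^+ 2 <= (sample_size alpha n)%:R :> R.
Proof.
move=> a0; near=> n.
(* Using 13 in place of 12 absorbs the loss of at most 1 from truncation. *)
have [n1 nbig] : 1 <= n%:R :> R /\ 13 * (3 / alpha) ^+ 3 <= n%:R.
  by split; near: n; exact: nbhs_infty_ger.
have /truncn_itv/andP[_] := expR_ge0 (alpha * n%:R).
rewrite -/(sample_size alpha n) -natr1 => /ltW.
have := @expRX_lower 3 (alpha * n%:R / 3).
rewrite mulrCA mulfV ?mulr1 ?pnatr_eq0// => /(_ _)/le_trans h /h {h} => h.
have {}h : (alpha * n%:R / 3) ^+ 3 <= (sample_size alpha n)%:R + 1.
  by apply: h; rewrite divr_ge0// mulr_ge0// ltW.
suff : 13 * n%:R ^+ 2 <= (alpha * n%:R / 3) ^+ 3 by move=> h'; nra.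
have -> : (alpha * n%:R / 3) ^+ 3 = n%:R ^+ 2 * (n%:R / (3 / alpha) ^+ 3).
  by field; rewrite gt_eqF.
rewrite mulrC ler_wpM2l ?exprn_ge0// ler_pdivlMr// exprn_gt0// divr_gt0//.
Unshelve. all: by end_near. Qed.

(** Since (1 - 1/(4n))^N <= e^(-3n) and 2^n <= e^n, the product is at most 2n e^(-2n), and e^(2n) >=
    (n + 1)^2. The factor 2^n is the ratio of the crude count 4^n to the expected 2^n. *)
Lemma missed_vertex_bound (n N : nat) : (0 < n)%N ->
  12 * n%:R ^+ 2 <= N%:R :> R ->
  2 ^+ n * ((2 * n)%:R * (1 - (4 * n%:R)^-1) ^+ N) <= 2 * n.+1%:R^-1 :> R.
Proof.
move=> n_gt0 nN; have n0 : (0 < n%:R :> R) by rewrite ltr0n.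
have n1 : (1 <= n%:R :> R) by rewrite ler1n.
have p1 : (4 * n%:R)^-1 <= 1 :> R by rewrite invf_le1; lra.
have le3 : (1 - (4 * n%:R)^-1) ^+ N <= expR (- (3 * n%:R)) :> R.
  apply: le_trans (exprB_le_expRN N p1) _; rewrite ler_expR lerN2.
  by rewrite ler_pdivlMr ?mulr_gt0//; nra.
apply: (@le_trans _ _ (expR n%:R * ((2 * n)%:R * expR (- (3 * n%:R))))).
  by rewrite ler_pM ?mulr_ge0 ?exprn_ge0 ?exprn2_le_expR ?ler_wpM2l// subr_ge0.
rewrite mulrCA -expRD (_ : n%:R + - (3 * n%:R) = - (2 * n%:R)); last by ring.
rewrite expRN natrM -mulrA ler_pM2l//.
rewrite ler_pdivrMr ?expR_gt0// mulrC ler_pdivlMr ?ltr0n// -[n.+1%:R]natr1.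
have e1 := expR_ge1Dx (n%:R : R).
by rewrite expRM_natl expr2; nra.
Qed.

(** * Consequences of a relative error of order 1/n around 2^n *)

Section growth.
Variable r : nat -> R.
Hypothesis r_near : \forall n \near \oo,
  `|r n / 2 ^+ n - 1| <= 3 * n.+1%:R^-1.

Lemma relative_error_cvg0 : (fun n => r n / 2 ^+ n - 1) @ \oo --> (0 : R).
Proof.
apply/norm_cvg0P; apply: (@squeeze_cvgr _ _ _ _ (fun=> 0) (fun n => 3 * harmonic n)).
- near=> n; rewrite normr_ge0 /=; near: n; exact: r_near.
- exact: cvg_cst.
- by rewrite -[X in _ --> X](mulr0 3); apply: cvgMr; exact: cvg_harmonic.
Unshelve. all: by end_near. Qed.

Lemma near_pow2 : \forall n \near \oo, 2^-1 * 2 ^+ n <= r n <= 2 * 2 ^+ n.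
Proof.
near=> n; have p2 : 0 < 2 ^+ n :> R by rewrite exprn_gt0.
rewrite -(divfK (lt0r_neq0 p2) (r n)) !ler_pM2r//.
have : `|r n / 2 ^+ n - 1| <= 2^-1.
  apply: (@le_trans _ _ (3 * n.+1%:R^-1)); first by near: n; exact: r_near.
  rewrite ler_pdivrMr ?ltr0n// -natr1.
  have : 5 <= n%:R :> R by near: n; exact: nbhs_infty_ger.
  by lra.
by rewrite ler_norml => /andP[lo hi]; apply/andP; split; lra.
Unshelve. all: by end_near. Qed.

Lemma ln_bigO : (fun n => ln (r n) : R^o) =O_\oo (fun n => n%:R : R^o).
Proof.
apply/eqO_exP; exists 2; first by [].
near=> n; have [n1 /andP[lo hi]] : (0 < n)%N /\ 2^-1 * 2 ^+ n <= r n <= 2 * 2 ^+ n.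
  by split; near: n; [exact: nbhs_infty_gt|exact: near_pow2].
have n1' : 1 <= n%:R :> R by rewrite ler1n.
(* This makes the logarithm nonnegative, so only its upper bound n + 1 <= 2n is left to prove. *)
have r1 : 1 <= r n.
  apply: le_trans lo; case: (n) n1 => // m _.
  by rewrite exprS mulrA mulVf// mul1r exprn_ege1// ler1n.
rewrite !ger0_norm ?ler0n ?ln_ge0//.
apply: (@le_trans _ _ n.+1%:R); last by rewrite -natr1; lra.
rewrite -[leRHS]expRK ler_ln ?posrE ?expR_gt0//; last by lra.
by apply: le_trans hi _; rewrite -exprS exprn2_le_expR.
Unshelve. all: by end_near. Qed.

(** Once n >= e^(2(C + 2)), the denominator is at least e^(2n), while r n <= 2 e^n; the ratio is
    then at most 2 e^(-n) <= 2 / (n + 1). *)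
Lemma superexponential_ratio (C : R) :
  (fun n => r n / (n%:R `^ (n%:R / 2) * expR (- (C * n%:R)))) @ \oo --> (0 : R).
Proof.
apply: (@squeeze_cvgr _ _ _ _ (fun=> 0) (fun n => 2 * harmonic n)).
- near=> n; have /andP[lo hi] : 2^-1 * 2 ^+ n <= r n <= 2 * 2 ^+ n.
    by near: n; exact: near_pow2.
  have nK : expR (2 * (C + 2)) <= n%:R by near: n; exact: nbhs_infty_ger.
  have p2 : 0 < 2 ^+ n :> R by rewrite exprn_gt0.
  have pow_ge : expR ((C + 2) * n%:R) <= n%:R `^ (n%:R / 2).
    rewrite (_ : (C + 2) * n%:R = 2 * (C + 2) * (n%:R / 2)); last by field.
    by rewrite expRM ge0_ler_powR ?nnegrE ?expR_ge0.
  have den_ge : expR (2 * n%:R) <= n%:R `^ (n%:R / 2) * expR (- (C * n%:R)).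
    rewrite expRN ler_pdivlMr ?expR_gt0// -expRD.
    by rewrite (_ : _ + _ = (C + 2) * n%:R)//; ring.
  have den_gt0 := lt_le_trans (expR_gt0 _) den_ge.
  rewrite divr_ge0 ?(ltW den_gt0)//=; last by lra.
  rewrite ler_pdivrMr// (le_trans hi)// -mulrA ler_pM2l//.
  apply: le_trans (exprn2_le_expR n) _; rewrite ler_pdivlMl ?ltr0n//.
  apply: le_trans den_ge; rewrite (_ : 2 * n%:R = n%:R + n%:R); last by ring.
  rewrite expRD ler_pM2r ?expR_gt0// -natr1 addrC; exact: expR_ge1Dx.
- exact: cvg_cst.
- by rewrite -[X in _ --> X](mulr0 2); apply: cvgMr; exact: cvg_harmonic.
Unshelve. all: by end_near. Qed.

End growth.

End asymptotics.

(** * Failure of log-concavity and the choice of the exceptional mass *)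

Lemma not_log_concave (R : realType) (n : nat) (nu : probability (borel_rV R n) R)
    (a : 'I_n -> R) (p e : R) : (0 < n)%N -> (forall i, 0 < a i) -> 0 < e < p ->
  (forall k, p%:E <= nu [set cross_vertex a k])%E ->
  (nu (~` range (cross_vertex a)) <= e%:E)%E -> ~ log_concave_measure nu.
Proof.
move=> n_gt0 a0 /andP[e0 ep] nuv nuoff nulc; pose i0 := Ordinal n_gt0.
pose v b := [set cross_vertex a (i0, b)].
have cv b : compact (v b) by exact: compact_set1.
have := nulc (v true) (v false) 2^-1 (cv true) (cv false).
(* With t = 1/2 the Minkowski combination of two opposite vertices is the origin, and log-concavity
   would give p <= nu {0} <= e. *)
rewrite (_ : 1 - 2^-1 = 2^-1); last by lra.
have -> : [set 2^-1 *: y + 2^-1 *: z | y in v true & z in v false] = [set 0].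
  apply/seteqP; split=> [_ [_ -> [_ -> <-]]|_ ->] /=.
    by rewrite -scalerDr -[true]/(~~ false) cross_vertexN addNr scaler0.
  exists (cross_vertex a (i0, true)) => //.
  exists (cross_vertex a (i0, false)) => //.
  by rewrite -scalerDr -[true]/(~~ false) cross_vertexN addNr scaler0.
have half : 0 < (2^-1 : R) < 1 by apply/andP; split; lra.
move=> /(_ half) le0.
have nu0 : (nu [set (0%R : borel_rV R n)] <= e%:E)%E.
  apply: le_trans nuoff; apply: le_measure; rewrite ?inE.
  - exact: measurable_rV1.
  - by apply: measurableC; exact: measurable_vertices.
  (* The origin is not a vertex: the form of constant sign [b] is 1 at the vertex [(i, b)] and 0 at
     the origin. *)
  - move=> _ -> [[i b] _] /(congr1 (sign_form a [ffun=> b])).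
    by rewrite sign_form_vertex// linear0 ffunE addbb => /eqP; rewrite oner_eq0.
have p0 : 0 < p by exact: lt_trans ep.
have nuv' b : ((Num.sqrt p)%:E <= nu (v b) `^ 2^-1)%E.
  by rewrite poweR12_sqrt// -[leLHS]/(sqrte p%:E) lee_sqrt//; exact: nuv.
have : (p%:E <= e%:E)%E.
  apply: le_trans nu0; apply: le_trans le0.
  rewrite -(sqr_sqrtr (ltW p0)) expr2 EFinM.
  by apply: lee_pmul; rewrite ?lee_fin ?sqrtr_ge0.
by rewrite lee_fin leNgt ep.
Qed.

(* The factor N 2^N beats the union bound over the N points times the trivial
   bound 2^N on the number of facets. *)
Definition off_mass (R : realType) (n N : nat) : R :=
  (4 * n.+1%:R * N.+1%:R * 2 ^+ N)^-1.

Lemma off_mass_lt (R : realType) n N : (0 < n)%N ->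
  0 < off_mass R n N < (4 * n%:R)^-1.
Proof.
move=> n_gt0; have n0 : 0 < n%:R :> R by rewrite ltr0n.
rewrite invr_gt0 !mulr_gt0 ?exprn_gt0 ?ltr0n//=.
rewrite ltf_pV2 ?posrE ?mulr_gt0 ?exprn_gt0 ?ltr0n//.
apply: (@lt_le_trans _ _ (4 * n.+1%:R)); first by rewrite ltr_pM2l// ltr_nat.
by rewrite -mulrA ler_peMr ?mulr_ge0// mulr_ege1 ?ler1n// exprn_ege1// ler1n.
Qed.

Lemma off_mass_le (R : realType) n N :
  2 ^+ N * (N%:R * off_mass R n N) <= n.+1%:R^-1.
Proof.
have n0 : 0 < n.+1%:R :> R by rewrite ltr0n.
have N0 : 0 < N.+1%:R :> R by rewrite ltr0n.
have p2 : 0 < 2 ^+ N :> R by rewrite exprn_gt0.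
have -> : 2 ^+ N * (N%:R * off_mass R n N) =
    n.+1%:R^-1 * (N%:R / N.+1%:R / 4) :> R.
  by rewrite /off_mass; field; rewrite !gt_eqF.
rewrite ler_piMr ?invr_ge0 ?(ltW n0)// ler_pdivrMr// mul1r ler_pdivrMr// -natr1.
by have := ler0n R N; lra.
Qed.

(** After division by 2^n the error is at most 2^n miss + 2^N N e, whose terms are bounded by 2 / (n
    + 1) and 1 / (n + 1). *)
Lemma relative_error_bound (R : realType) (alpha : R) (r : nat -> R) :
  0 < alpha ->
  (forall n, (0 < n)%N -> let N := sample_size alpha n in
    let miss := (2 * n)%:R * (1 - (4 * n%:R)^-1) ^+ N in
    let e := off_mass R n N in
    2 ^+ n * (1 - miss - N%:R * e) <= r n <=
    2 ^+ n + 4 ^+ n * miss + 2 ^+ N * (N%:R * e)) ->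
  \forall n \near \oo, `|r n / 2 ^+ n - 1| <= 3 * n.+1%:R^-1.
Proof.
move=> alpha0 rP; near=> n; have n_gt0 : (0 < n)%N by near: n; exact: nbhs_infty_gt.
have big : 12 * n%:R ^+ 2 <= (sample_size alpha n)%:R :> R.
  by near: n; exact: sample_size_superquadratic.
have := missed_vertex_bound n_gt0 big.
have := off_mass_le R n (sample_size alpha n).
have := rP n n_gt0; set N := sample_size alpha n => /=.
set miss := (2 * n)%:R * _; set x := N%:R * _; set u := n.+1%:R^-1.
have n1 : 1 <= n%:R :> R by rewrite ler1n.
have miss0 : 0 <= miss.
  rewrite mulr_ge0// exprn_ge0// subr_ge0 invf_le1 ?mulr_gt0 ?ltr0n//.
  by lra.
have x0 : 0 <= x by rewrite mulr_ge0//; have /andP[/ltW] := off_mass_lt R N n_gt0.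
have p2 : 1 <= 2 ^+ n :> R by rewrite exprn_ege1// ler1n.
have pN : 1 <= 2 ^+ N :> R by rewrite exprn_ege1// ler1n.
have p2' : 0 < 2 ^+ n :> R by apply: lt_le_trans p2.
have -> : 4 ^+ n = 2 ^+ n * 2 ^+ n :> R by rewrite -exprMn; congr (_ ^+ _); ring.
rewrite -(divfK (lt0r_neq0 p2') (r n)); set q := r n / 2 ^+ n.
rewrite mulfK ?gt_eqF//.
move: p2 pN p2'; set t := 2 ^+ n; set v := 2 ^+ N => p2 pN p2'.
move=> /andP[lo hi] vx tm; rewrite ler_norml.
have {}lo : 1 - miss - x <= q by rewrite -(ler_pM2l p2') (mulrC t q).
have {}hi : q <= 1 + t * miss + v * x.
  rewrite -(ler_pM2r p2') (le_trans hi)//.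
  have : v * x * 1 <= v * x * t by rewrite ler_wpM2l// mulr_ge0//; lra.
  by nra.
have mt : 1 * miss <= t * miss by rewrite ler_wpM2r.
have xv : 1 * x <= v * x by rewrite ler_wpM2r.
by apply/andP; split; lra.
Unshelve. all: by end_near. Qed.

Theorem proposition3p1 (R : realType) (alpha : R) (halpha : 0 < alpha) :
  exists nu : forall n : nat, probability (borel_rV R n) R,
    (forall n : nat, (0 < n)%N ->
       [/\ symmetric_measure (nu n), isotropic (nu n),
           measure_support (nu n) = setT & ~ log_concave_measure (nu n)]) /\
    forall (d : nat -> measure_display)
      (Omega : forall n : nat, measurableType (d n))
      (P : forall n : nat, probability (Omega n) R)
      (X : forall n : nat,
         'I_(sample_size alpha n) -> {RV (P n) >-> borel_rV R n}),
      (forall n : nat, (0 < n)%N -> iid_sample (nu n) (X n)) ->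
      let Ef (n : nat) : \bar R :=
        'E_(P n)[fun w : Omega n =>
          (nb_faces n.-1 (conv_hull (fun i => X n i w : 'rV[R]_n)))%:R]%E in
      [/\ exists eps : nat -> R, eps @ \oo --> (0 : R) /\
            \forall n \near \oo, Ef n = ((1 + eps n) * 2 ^+ n)%:E,
          exists g : nat -> R^o, g =O_\oo (fun n : nat => n%:R : R^o) /\
            \forall n \near \oo, Ef n = (expR (g n))%:E &
          forall C : R, 0 < C ->
            (fun n : nat =>
               (Ef n / (n%:R `^ (n%:R / 2) * expR (- (C * n%:R)))%:E)%E)
              @ \oo --> (0 : \bar R)%E].
Proof.
pose N := sample_size alpha.
have nu_ex n : exists nu : probability (borel_rV R n) R, (0 < n)%N ->
    exists a : 'I_n -> R, [/\ forall i, 0 < a i,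
      symmetric_measure nu, isotropic nu, measure_support nu = setT &
      (forall k, ((4 * n%:R)^-1)%:E <= nu [set cross_vertex a k])%E /\
      (nu (~` range (cross_vertex a)) <= (off_mass R n (N n))%:E)%E].
  (* In dimension 0 an arbitrary probability is taken, the conclusions being claimed for n > 0 or
     for large n. *)
  have [n_gt0|] := boolP (0 < n)%N; last by move=> _; exists point.
  by have [nu nuP] := cross_measure n_gt0 (off_mass_lt R (N n) n_gt0); exists nu.
pose nu n := projT1 (cid (nu_ex n)).
have nuP n : (0 < n)%N -> _ := projT2 (cid (nu_ex n)).
exists nu; split=> [n n_gt0|d Omega P X X_iid Ef].
  have [a [a0 nu_sym nu_iso nu_supp [nu_vertex nu_off]]] := nuP n n_gt0.
  split=> //.
  exact: (not_log_concave n_gt0 a0 (off_mass_lt R (N n) n_gt0) nu_vertex nu_off).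
have /choice[r rP] : forall n, exists r : R, (0 < n)%N -> Ef n = r%:E /\
    2 ^+ n * (1 - (2 * n)%:R * (1 - (4 * n%:R)^-1) ^+ N n -
      (N n)%:R * off_mass R n (N n)) <= r <=
    2 ^+ n + 4 ^+ n * ((2 * n)%:R * (1 - (4 * n%:R)^-1) ^+ N n) +
      2 ^+ N n * ((N n)%:R * off_mass R n (N n)).
  move=> n; have [n_gt0|] := boolP (0 < n)%N; last by exists 0.
  have [a [a0 _ _ _ [nu_vertex nu_off]]] := nuP n n_gt0.
  have [r rE rle] := expected_facets n_gt0 a0 nu_vertex nu_off (X_iid n n_gt0).
  by exists r.
have r_near := relative_error_bound halpha (fun n n_gt0 => (rP n n_gt0).2).
have Ef_near : \forall n \near \oo, Ef n = (r n)%:E.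
  by near=> n; apply: (rP n _).1; near: n; exact: nbhs_infty_gt.
split.
- exists (fun n => r n / 2 ^+ n - 1); split; first exact: relative_error_cvg0.
  near=> n; have -> : Ef n = (r n)%:E by near: n; exact: Ef_near.
  by rewrite addrC subrK divfK// expf_neq0.
- exists (fun n => ln (r n)); split; first exact: ln_bigO.
  near=> n; have -> : Ef n = (r n)%:E by near: n; exact: Ef_near.
  rewrite lnK// posrE; have /andP[lo _] : 2^-1 * 2 ^+ n <= r n <= 2 * 2 ^+ n.
    by near: n; exact: near_pow2.
  by apply: lt_le_trans lo; rewrite mulr_gt0 ?exprn_gt0.
(* Convergence in the extended reals to a finite limit splits into eventual finiteness and
   convergence of the real parts. *)
- move=> C C0; apply/fine_cvgP.
  have rat_near : \forall n \near \oo,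
      (Ef n / (n%:R `^ (n%:R / 2) * expR (- (C * n%:R)))%:E)%E =
      (r n / (n%:R `^ (n%:R / 2) * expR (- (C * n%:R))))%:E.
    near=> n; have -> : Ef n = (r n)%:E by near: n; exact: Ef_near.
    rewrite inver gt_eqF// mulr_gt0 ?expR_gt0// powR_gt0// ltr0n.
    by near: n; exact: nbhs_infty_gt.
  split; first by near=> n; rewrite (near rat_near n).
  apply: cvg_trans (superexponential_ratio r_near C); apply: near_eq_cvg.
  by near=> n; rewrite /= (near rat_near n).
Unshelve. all: by end_near. Qed.
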